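(* Let $X$ be a locally compact Hausdorff connected space, let $\rho$ be a quasi-linear functional on $C_0(X)$ with $\|\rho\|<\infty$, and let $\mu=\mu_\rho$ be the corresponding topological measure. If $f\in C_0(X)$ then $$|\rho(f)|\le\|f\|\,\mu(X)=\|f\|\,\|\rho\|.$$ If $f,g\in C_0(X)$ and $f,g\ge0$ then $$|\rho(f)-\rho(g)|\le\|f-g\|\,\mu(X)=\|f-g\|\,\|\rho\|.$$ For arbitrary $f,g\in C_0(X)$, $$|\rho(f)-\rho(g)|\le2\|f-g\|\,\mu(X)=2\|f-g\|\,\|\rho\|.$$
   Context: $C_0(X)$, $C_c(X)$, $C_b(X)$ are the real-valued continuous functions on $X$ vanishing at infinity, with compact support, and bounded, respectively, with the uniform norm $\|\cdot\|$ (all equal to $C(X)$ if $X$ is compact); $\operatorname{supp} f=\overline{\{f\neq0\}}$. Singly generated subalgebra: for $f\in C_b(X)$, $S(f)$ is the smallest uniformly closed subalgebra of $C_b(X)$ containing $f$ and, if $X$ is compact, also containing the constant $1$. (If $X$ is compact, $S(f)=\{\phi\circ f:\phi\in C(f(X))\}$; if $X$ is not compact and $f\in C_0(X)$, $S(f)=\{\phi\circ f:\phi\in C(\overline{f(X)}),\ \phi(0)=0\}\subseteq C_0(X)$.) Quasi-linear functional on $C_0(X)$: a map $\rho:C_0(X)\to\mathbb R$ with $\rho(af)=a\rho(f)$ for $a\in\mathbb R$; $\rho(f+g)=\rho(f)+\rho(g)$ whenever $f,g\in S(h)$ for some $h\in C_0(X)$; and $\rho(f)\ge0$ whenever $f\ge0$.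 Its norm is $\|\rho\|=\sup\{\rho(f): f\in C_0(X),\ 0\le f\le1\}$. The set function $\mu_\rho$ (on open and closed subsets of $X$) is defined by $\mu_\rho(U)=\sup\{\rho(f): f\in C_c(X),\ 0\le f\le1,\ \operatorname{supp} f\subseteq U\}$ for $U$ open, and $\mu_\rho(F)=\inf\{\mu_\rho(U):F\subseteq U,\ U\text{ open}\}$ for $F$ closed. *)

(* Defs.v *)
From mathcomp Require Import all_boot all_order all_algebra.
From mathcomp Require Import all_classical all_reals all_analysis.

Set Implicit Arguments.
Unset Strict Implicit.
Unset Printing Implicit Defensive.

Import Order.TTheory GRing.Theory Num.Theory.
Import numFieldNormedType.Exports.

Local Open Scope classical_set_scope.
Local Open Scope ring_scope.

Definition Cb (R : realType) (X : topologicalType) : set (X -> R) :=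
  [set f | continuous f /\ bounded_fun f].

Definition C0 (R : realType) (X : topologicalType) : set (X -> R) :=
  [set f | continuous f /\ forall e : R, 0 < e -> compact [set x | e <= `|f x|]].

Definition supp (R : realType) (X : topologicalType) (f : X -> R) : set X :=
  closure [set x | f x != 0].

Definition Cc (R : realType) (X : topologicalType) : set (X -> R) :=
  [set f | continuous f /\ compact (supp f)].

(* A real supremum: meaningful for bounded f, and 0 when X is empty. *)
Definition unorm (R : realType) (X : topologicalType) (f : X -> R) : R :=
  sup (range (fun x => `|f x|)).

(* Subalgebras are not required to contain 1. *)
Definition subalgebra (R : realType) (X : topologicalType)
    (A : set (X -> R)) : Prop :=
  [/\ A `<=` @Cb R X,
      A (cst 0),
      forall (a : R) f, A f -> A (fun x => a * f x),
      forall f g, A f -> A g -> A (f \+ g) &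
      forall f g, A f -> A g -> A (f \* g)].

(* The singly generated algebra S(f). *)
Definition Sgen (R : realType) (X : topologicalType) (f : X -> R) :
    set (X -> R) :=
  smallest (fun A : set (X -> R) =>
      [/\ subalgebra A,
          closed (A : set {uniform X -> R}) &
          compact [set: X] -> A (cst 1)])
    [set f].

(* A functional on C0 is given by a total map on X -> R whose values outside C0
   are unconstrained and never used. *)
Definition quasi_linear (R : realType) (X : topologicalType)
    (rho : (X -> R) -> R) : Prop :=
  [/\ forall (a : R) f, C0 f -> rho (fun x => a * f x) = a * rho f,
      forall h f g, C0 h -> C0 f -> C0 g -> Sgen h f -> Sgen h g ->
        rho (f \+ g) = rho f + rho g &
      forall f, C0 f -> (forall x, 0 <= f x) -> 0 <= rho f].

Definition ql_norm (R : realType) (X : topologicalType)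
    (rho : (X -> R) -> R) : \bar R :=
  ereal_sup [set (rho f)%:E | f in
    [set f : X -> R | C0 f /\ forall x, 0 <= f x <= 1]].

Definition mu_open (R : realType) (X : topologicalType)
    (rho : (X -> R) -> R) (U : set X) : \bar R :=
  ereal_sup [set (rho f)%:E | f in
    [set f : X -> R | [/\ Cc f, forall x, 0 <= f x <= 1 & supp f `<=` U]]].

(* Only the values on open and on closed sets are meaningful; on clopen sets
   the two clauses agree, since mu_open is monotone. *)
Definition mu_rho (R : realType) (X : topologicalType)
    (rho : (X -> R) -> R) (A : set X) : \bar R :=
  if `[< open A >] then mu_open rho A
  else ereal_inf [set mu_open rho U | U in [set U | open U /\ A `<=` U]].

(* Main.v *)
(* Let N be the norm of rho. A closed subalgebra is stable under truncation
   f |-> min(f, a) for a >= 0, so rho is additive on slices of a function. If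
   f, g >= 0 and f <= g + c, cut f and g into slices of thickness d: the slice
   of f above level c + a + d is supported where the slice of g above level a
   is at its maximum d, so the two slices lie in a common singly generated
   algebra and rho is monotone on them. Summing up,
   rho f <= rho g + (c + d) N, and d tends to 0; no constant function is
   needed, so compact and noncompact X are treated alike. Signed functions are
   split into positive and negative parts, and mu(X) = N follows by
   approximating f with f - min(f, e), which has compact support. *)

Require Import Defs.
From mathcomp Require Import all_boot all_order all_algebra.
From mathcomp Require Import all_classical all_reals all_analysis.
From mathcomp Require Import ring lra.
Import Order.TTheory GRing.Theory Num.Theory.
Import numFieldNormedType.Exports.
Local Open Scope classical_set_scope.
Local Open Scope ring_scope.

(** * Polynomial approximation of the absolute value *)

(* The iteration p |-> p + (x^2 - p^2) / 2 increases to |x| on [-1, 1]. *)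
Fixpoint abs_poly (R : realType) (n : nat) : {poly R} :=
  if n is k.+1 then
    abs_poly R k + 2^-1 *: ('X^2 - abs_poly R k ^+ 2)
  else 0.

(** With t = |s|, one step multiplies the error t - p by 1 - (t + p) / 2, which lies in
    [0, 1 - t / 2] when 0 <= p <= t <= 1. *)
Lemma abs_poly_bound (R : realType) (n : nat) (s : R) : `|s| <= 1 ->
  0 <= (abs_poly R n).[s] /\
  0 <= `|s| - (abs_poly R n).[s] <= `|s| * (1 - `|s| / 2) ^+ n.
Proof.
move=> s1; have s0 := normr_ge0 s.
elim: n => [|n [p0 /andP[dp0 dp]]] /=.
  by rewrite horner0 subr0 expr0 mulr1 lexx s0.
rewrite !hornerE -(real_normK (num_real s)) (exprS _ n).
move: (abs_poly R n).[s] p0 dp0 dp => p p0 dp0 dp.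
move: (`|s|) s0 s1 dp0 dp => t t0 t1 dp0 dp.
have -> : t - (p + 2^-1 * (t ^+ 2 - p ^+ 2)) = (t - p) * (1 - (t + p) / 2).
  by field.
split; first by nra.
apply/andP; split; first by apply: mulr_ge0; lra.
rewrite mulrCA mulrC; apply: ler_pM => //; lra.
Qed.

(** The left side decreases in n, by (1 - u)^n u^2 (n + 1) at each step. For u = t / 2 this gives n
    t (1 - t / 2)^n <= 2, an error bound uniform in t. *)
Lemma bernoulli_pow (R : realType) (n : nat) (u : R) : 0 <= u <= 1 ->
  (1 - u) ^+ n * (1 + n%:R * u) <= 1.
Proof.
move=> /andP[u0 u1]; elim: n => [|n IH]; first by rewrite mul0r addr0 mulr1.
apply: le_trans IH; rewrite exprS -natr1.
have pn : 0 <= (1 - u) ^+ n by apply: exprn_ge0; lra.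
have n0 : 0 <= n%:R :> R by [].
move: pn n0; move: ((1 - u) ^+ n) (n%:R : R) => a b a0 b0.
rewrite -subr_ge0.
have -> : a * (1 + b * u) - (1 - u) * a * (1 + (b + 1) * u) =
  a * (u ^+ 2 * (b + 1)) by ring.
by rewrite !mulr_ge0 ?sqr_ge0 ?addr_ge0.
Qed.

Lemma abs_poly_approx (R : realType) (M e : R) : 0 < M -> 0 < e ->
  exists p : {poly R}, forall s, `|s| <= M -> `| `|s| - p.[s] | < e.
Proof.
move=> M0 e0.
(* Rescaling [-M, M] to [-1, 1] turns the error 2 / n into 2 M / n. *)
have [n hn] : exists n : nat, 2 * M / e < n%:R.
  by exists (Num.bound (2 * M / e)); rewrite archi_boundP// divr_ge0 ?mulr_ge0// ltW.
exists (M *: (abs_poly R n \Po (M^-1 *: 'X))) => s sM.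
rewrite hornerZ horner_comp hornerZ hornerX.
have tE : `|M^-1 * s| = `|s| / M.
  by rewrite normrM normfV (gtr0_norm M0) mulrC.
have t1 : `|M^-1 * s| <= 1 by rewrite tE ler_pdivrMr// mul1r.
have [_ /andP[d0 d1]] := abs_poly_bound R n _ t1.
have -> : `|s| = M * `|M^-1 * s| by rewrite tE mulrC divfK// gt_eqF.
rewrite -mulrBr normrM (gtr0_norm M0) (ger0_norm d0).
apply: (@le_lt_trans _ _ (M * (`|M^-1 * s| * (1 - `|M^-1 * s| / 2) ^+ n))).
  by apply: ler_wpM2l d1; exact: ltW.
move: (`|M^-1 * s|) (normr_ge0 (M^-1 * s)) t1 => t t0 t1 {tE d0 d1}.
have u01 : 0 <= t / 2 <= 1 by lra.
have := bernoulli_pow R n _ u01.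
have : 0 <= (1 - t / 2) ^+ n by apply: exprn_ge0; lra.
move: ((1 - t / 2) ^+ n) => a a0 ha.
rewrite ltr_pdivrMr// in hn.
have n0 : 0 <= n%:R :> R by [].
have na : n%:R * (t * a) <= 2 by nra.
have ta0 : 0 <= t * a by exact: mulr_ge0.
have [->|ta] := eqVneq (t * a) 0; first by rewrite mulr0.
have {ta}ta0 : 0 < t * a by rewrite lt_def ta.
have : 2 * M * (t * a) < n%:R * e * (t * a) by rewrite ltr_pM2r.
nra.
Qed.

(** * Closed subalgebras and truncation *)

Lemma uniform_closed_approx (R : realType) (X : topologicalType)
    (A : set (X -> R)) (f : X -> R) :
  closed (A : set {uniform X -> R}) ->
  (forall e, 0 < e -> exists2 g, A g & forall x, `|f x - g x| < e) -> A f.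
Proof.
move=> cA H; apply: cA => B /uniform_nbhs[E [entE EB]].
move: entE; rewrite -entourage_ballE => -[e /= e0 eE].
have [g Ag fg] := H _ e0.
by exists g; split => //; apply: EB => x _; apply: eE; exact: fg.
Qed.

(** The constant term is removed since constants may be missing from [A]. For p = q X + c the
    function is (q(f) - q(0)) f + q(0) f. *)
Lemma subalgebra_poly (R : realType) (X : topologicalType)
    (A : set (X -> R)) (f : X -> R) (p : {poly R}) :
  subalgebra A -> A f -> A (fun x => p.[f x] - p.[0]).
Proof.
move=> [_ A0 AZ AD AM] Af; elim/poly_ind: p => [|q c IH].
  rewrite (_ : (fun _ => _) = cst 0)//; apply/funext => x.
  by rewrite !horner0 subrr.
rewrite (_ : (fun _ => _) = ((fun x => q.[f x] - q.[0]) \* f) \+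
    (fun x => q.[0] * f x)); last by apply/funext => x /=; rewrite !hornerE; ring.
exact: AD (AM _ _ IH Af) (AZ _ _ Af).
Qed.

Lemma Cb_bounded (R : realType) (X : topologicalType) (f : X -> R) :
  Cb f -> exists2 M, 0 < M & forall x, `|f x| <= M.
Proof.
move=> [_ /= /ex_strict_bound_gt0[M M0 HM]].
by exists M => // x; apply/ltW/HM.
Qed.

(** Here min(f, a) = f / 2 - (|f - a| - a) / 2, and s |-> |s - a| - a vanishes at 0 because a >= 0,
    so it is a limit of polynomials without constant term. *)
Lemma subalgebra_min (R : realType) (X : topologicalType)
    (A : set (X -> R)) (f : X -> R) (a : R) :
  subalgebra A -> closed (A : set {uniform X -> R}) -> 0 <= a -> A f ->
  A (fun x => Num.min (f x) a).
Proof.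
move=> sA cA a0 Af; have [AC A0 AZ AD AM] := sA.
have [M M0 fM] := Cb_bounded _ _ _ (AC _ Af).
have Aabs : A (fun x => `|f x - a| - a).
  apply: uniform_closed_approx cA _ => e e0.
  (* The approximation is used at f x - a and at -a, both within M + a of 0; each use costs e /
     2. *)
  have [p Hp] := abs_poly_approx R (M + a) (e / 2) (ltr_wpDr a0 M0)
    (divr_gt0 e0 (ltr0Sn _ _)).
  exists (fun x => (p \Po ('X - a%:P)).[f x] - (p \Po ('X - a%:P)).[0]).
    exact: subalgebra_poly.
  move=> x; rewrite !horner_comp !hornerE.
  have h1 : `|f x - a| <= M + a.
    by apply: le_trans (ler_normB _ _) _; rewrite (ger0_norm a0) lerD2r.
  have h2 : `|- a| <= M + a by rewrite normrN ger0_norm//; lra.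
  have := Hp _ h1; have := Hp _ h2; rewrite normrN (ger0_norm a0).
  rewrite !ltr_norml; lra.
rewrite (_ : (fun _ => _) = (fun x => 2^-1 * f x) \+
    (fun x => - 2^-1 * (`|f x - a| - a))).
  exact: AD (AZ _ _ Af) (AZ _ _ Aabs).
apply/funext => x /=; case: (leP (f x) a) => h.
  by rewrite ler0_norm ?subr_le0//; lra.
by rewrite gtr0_norm ?subr_gt0//; lra.
Qed.

(** * Stability of the singly generated algebra *)

Lemma Sgen_gen (R : realType) (X : topologicalType) (h : X -> R) : Sgen h h.
Proof. by move=> A [_]; apply. Qed.

Lemma SgenZ (R : realType) (X : topologicalType) (h f : X -> R) (a : R) :
  Sgen h f -> Sgen h (fun x => a * f x).
Proof. move=> Sf A AA; case: (AA) => -[[_ _ AZ _ _] _ _] _; exact: AZ (Sf _ AA). Qed.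

Lemma SgenD (R : realType) (X : topologicalType) (h f g : X -> R) :
  Sgen h f -> Sgen h g -> Sgen h (f \+ g).
Proof.
move=> Sf Sg A AA; case: (AA) => -[[_ _ _ AD _] _ _] _.
exact: AD (Sf _ AA) (Sg _ AA).
Qed.

Lemma SgenB (R : realType) (X : topologicalType) (h f g : X -> R) :
  Sgen h f -> Sgen h g -> Sgen h (f \- g).
Proof.
move=> Sf Sg; rewrite (_ : f \- g = f \+ (fun x => -1 * g x)).
  by apply: SgenD => //; exact: SgenZ.
by apply/funext => x /=; rewrite mulN1r.
Qed.

Lemma Sgen_min (R : realType) (X : topologicalType) (h f : X -> R) (a : R) :
  0 <= a -> Sgen h f -> Sgen h (fun x => Num.min (f x) a).
Proof.
move=> a0 Sf A AA; case: (AA) => -[sA cA _] _.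
by apply: subalgebra_min => //; exact: Sf.
Qed.

(** * Functions vanishing at infinity and their norm *)

Lemma closed_norm_ge (R : realType) (X : topologicalType) (f : X -> R) (e : R) :
  continuous f -> closed [set x | e <= `|f x|].
Proof.
move=> cf; apply: (@preimage_closed _ _ (fun x => `|f x|) [set y | e <= y]).
  move=> x _; apply: (@continuous_comp _ _ _ f (fun y : R => `|y|)); first exact: cf.
  exact: (@norm_continuous _ R^o).
exact: closed_ge.
Qed.

(** Where |h| >= e, one of |f|, |g| is at least e / (2 K), so this closed set sits in a union of two
    compact sets. Sums, multiples and truncations are all handled this way. *)
Lemma C0_dominated (R : realType) (X : topologicalType) (f g h : X -> R) (K : R) :
  C0 f -> C0 g -> continuous h -> 0 < K ->
  (forall x, `|h x| <= K * (`|f x| + `|g x|)) -> C0 h.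
Proof.
move=> [_ Kf] [_ Kg] ch K0 hfg; split => // e e0.
have e'0 : 0 < e / (K * 2) by rewrite divr_gt0 ?mulr_gt0.
apply: (subclosed_compact _ (compactU (Kf _ e'0) (Kg _ e'0))).
  exact: closed_norm_ge.
move=> x /= ex; rewrite !ler_pdivrMr ?mulr_gt0//.
have := hfg x.
case: (leP (`|f x|) (`|g x|)) => fg hx; [right|left]; nra.
Qed.

Lemma C0D (R : realType) (X : topologicalType) (f g : X -> R) :
  C0 f -> C0 g -> C0 (f \+ g).
Proof.
move=> Cf Cg; apply: (C0_dominated _ _ f g _ 1) => //.
  by case: Cf Cg => [cf _] [cg _] x; apply: (@continuousD _ R^o _ f g x (cf x) (cg x)).
by move=> x; rewrite mul1r ler_normD.
Qed.

Lemma C0Z (R : realType) (X : topologicalType) (f : X -> R) (a : R) :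
  C0 f -> C0 (fun x => a * f x).
Proof.
(* The added 1 keeps the factor positive when a = 0. *)
move=> Cf; apply: (C0_dominated _ _ f f _ (`|a| + 1)) => //.
- by case: Cf => [cf _] x; apply: (continuousM _ (cf x)); exact: cst_continuous.
- by move=> x; rewrite normrM; have := normr_ge0 a; have := normr_ge0 (f x); nra.
Qed.

Lemma C0B (R : realType) (X : topologicalType) (f g : X -> R) :
  C0 f -> C0 g -> C0 (f \- g).
Proof.
move=> Cf Cg; rewrite (_ : f \- g = f \+ (fun x => -1 * g x)).
  by apply: C0D => //; exact: C0Z.
by apply/funext => x /=; rewrite mulN1r.
Qed.

Lemma C0_min (R : realType) (X : topologicalType) (f : X -> R) (a : R) :
  0 <= a -> C0 f -> C0 (fun x => Num.min (f x) a).
Proof.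
move=> a0 Cf; apply: (C0_dominated _ _ f f _ 1) => //.
  case: Cf => [cf _] x; apply: (@continuous_min R X f (cst a) x (cf x)).
  exact: (@cst_continuous X R^o a x).
move=> x; have := normr_ge0 (f x); have := ler_norm (f x).
by case: (leP (f x) a) => h; rewrite ?(ger0_norm a0); lra.
Qed.

(** The real supremum is meaningful because f is bounded: by compactness where |f| >= 1, and by 1
    elsewhere. *)
Lemma C0_le_unorm (R : realType) (X : topologicalType) (f : X -> R) (x : X) :
  C0 f -> `|f x| <= unorm f.
Proof.
move=> [cf Kf]; apply: ub_le_sup; last by exists x.
have : compact [set f x | x in [set x | 1 <= `|f x|]].
  by apply: continuous_compact (Kf _ ltr01); exact: continuous_subspaceT.
move=> /(@compact_bounded R R^o)/ex_strict_bound_gt0[M _ HM].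
exists (Num.max M 1) => _ [y _ <-]; rewrite le_max.
have [y1|/ltW->] := leP 1 (`|f y|); last by rewrite orbT.
by apply/orP; left; apply/ltW/HM; exists y.
Qed.

Lemma unorm_ge0 (R : realType) (X : topologicalType) (f : X -> R) :
  C0 f -> 0 <= unorm f.
Proof.
move=> Cf; have [[x _]|X0] := pselect ([set: X] !=set0).
  exact: le_trans (C0_le_unorm _ _ _ x Cf).
(* On an empty space the supremum takes its default value 0. *)
rewrite /unorm (_ : [set _ | _ in _] = set0) ?sup0//.
by apply/seteqP; split => // y [x _ _]; case: X0; exists x.
Qed.

(** * Quasi-linear functionals on slices of nonnegative functions *)

Lemma quasi_linear0 (R : realType) (X : topologicalType)
    (rho : (X -> R) -> R) (f : X -> R) :
  quasi_linear rho -> C0 f -> rho (cst 0) = 0.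
Proof.
move=> [rZ _ _] Cf; rewrite -[RHS](mul0r (rho f)) -rZ//; congr rho.
by apply/funext => x; rewrite mul0r.
Qed.

Lemma quasi_linearB (R : realType) (X : topologicalType)
    (rho : (X -> R) -> R) (h f g : X -> R) :
  quasi_linear rho -> C0 h -> C0 f -> C0 g -> Sgen h f -> Sgen h g ->
  rho (f \- g) = rho f - rho g.
Proof.
move=> [_ rD _] Ch Cf Cg Sf Sg; apply/eqP; rewrite eq_sym subr_eq; apply/eqP.
rewrite -(rD h) //; [|exact: C0B|exact: SgenB].
by congr rho; apply/funext => x /=; rewrite subrK.
Qed.

Lemma quasi_linear_bound (R : realType) (X : topologicalType)
    (rho : (X -> R) -> R) (N c : R) (f : X -> R) :
  quasi_linear rho ->
  (forall k, C0 k -> (forall x, 0 <= k x <= 1) -> rho k <= N) ->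
  0 <= c -> C0 f -> (forall x, 0 <= f x <= c) -> rho f <= c * N.
Proof.
move=> ql rN c0 Cf fc; have [rZ _ _] := ql.
have [c_eq0|c_neq0] := eqVneq c 0.
  rewrite (_ : f = cst 0) ?(quasi_linear0 _ _ _ _ ql Cf) ?c_eq0 ?mul0r//.
  by apply/funext => x; apply/eqP; have := fc x; rewrite c_eq0 eq_le andbC.
have {}c0 : 0 < c by rewrite lt_def c_neq0.
rewrite mulrC -ler_pdivrMr// mulrC -rZ//; apply: rN; first exact: C0Z.
move=> x; have /andP[f0 f1] := fc x.
by rewrite mulrC divr_ge0 ?(ltW c0)//= ler_pdivrMr// mul1r.
Qed.

(* [g] is constant where [f] does not vanish, so both are truncations of
   their sum and belong to the algebra it generates. *)
Lemma quasi_linear_le_plateau (R : realType) (X : topologicalType)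
    (rho : (X -> R) -> R) (d : R) (f g : X -> R) :
  quasi_linear rho -> C0 f -> C0 g -> 0 <= d ->
  (forall x, 0 <= f x <= d) -> (forall x, 0 <= g x <= d) ->
  (forall x, f x != 0 -> g x = d) ->
  rho f <= rho g.
Proof.
move=> ql Cf Cg d0 f01 g01 fg; have [_ _ rpos] := ql.
have Ch : C0 (f \+ g) by exact: C0D.
have gE : g = (fun x => Num.min ((f \+ g) x) d).
  apply/funext => x /=; have /andP[f0 _] := f01 x; have /andP[_ gd] := g01 x.
  have [->|/fg ->] := eqVneq (f x) 0; first by rewrite add0r; case: leP; lra.
  by case: leP; lra.
have Sg : Sgen (f \+ g) g by rewrite {2}gE; apply: Sgen_min d0 _; exact: Sgen_gen.
have Sf : Sgen (f \+ g) f.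
  rewrite {2}(_ : f = (f \+ g) \- g); first by apply: SgenB => //; exact: Sgen_gen.
  by apply/funext => x /=; rewrite addrK.
(* Positivity of g - f gives the inequality only because the common algebra lets [rho] split the
   difference. *)
rewrite -subr_ge0 -(quasi_linearB _ _ _ (f \+ g))//.
apply: rpos => [|x /=]; first exact: C0B.
have /andP[f0 fd] := f01 x; have /andP[g0 gd] := g01 x.
by have [->|/fg ->] := eqVneq (f x) 0; lra.
Qed.

(* The slice of [f] above [c + a + d] lives where [g] exceeds [a + d], that is,
   where the slice of [g] between [a] and [a + d] is at its plateau. *)
Lemma quasi_linear_slice (R : realType) (X : topologicalType)
    (rho : (X -> R) -> R) (a c d : R) (f g : X -> R) :
  quasi_linear rho -> C0 f -> C0 g -> 0 <= a -> 0 <= c -> 0 <= d ->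
  (forall x, f x <= g x + c) -> (forall x, 0 <= f x) -> (forall x, 0 <= g x) ->
  rho (fun x => Num.min (f x) (c + a + d + d)) -
    rho (fun x => Num.min (f x) (c + a + d)) <=
  rho (fun x => Num.min (g x) (a + d)) - rho (fun x => Num.min (g x) a).
Proof.
move=> ql Cf Cg a0 c0 d0 fg f0 g0.
(* Both truncations of k lie in S(k), so [rho] of a slice is a difference of two values. *)
have slice (k : X -> R) (b : R) : C0 k -> 0 <= b ->
    C0 ((fun x => Num.min (k x) (b + d)) \- (fun x => Num.min (k x) b)) /\
    rho ((fun x => Num.min (k x) (b + d)) \- (fun x => Num.min (k x) b)) =
    rho (fun x => Num.min (k x) (b + d)) - rho (fun x => Num.min (k x) b).
  move=> Ck b0; have bd0 : 0 <= b + d by rewrite addr_ge0.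
  split; first by apply: C0B; exact: C0_min.
  apply: (quasi_linearB _ _ _ k) => //; try exact: C0_min.
    by apply: Sgen_min => //; exact: Sgen_gen.
  by apply: Sgen_min => //; exact: Sgen_gen.
have cad0 : 0 <= c + a + d by rewrite !addr_ge0.
have [Csf <-] := slice _ _ Cf cad0; have [Csg <-] := slice _ _ Cg a0.
apply: (quasi_linear_le_plateau _ _ _ d) => //= x.
- by case: (leP (f x) (c + a + d)); case: (leP (f x) (c + a + d + d)); lra.
- by case: (leP (g x) a); case: (leP (g x) (a + d)); lra.
- have := fg x; case: (leP (f x) (c + a + d)) => h1;
    case: (leP (f x) (c + a + d + d)) => h2; case: (leP (g x) a) => h3;
    case: (leP (g x) (a + d)) => h4; rewrite ?subrr ?eqxx//; lra.
Qed.

(** Comparing slices level by level leaves only the bottom of f, of thickness c + d, which costs at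
    most (c + d) N. For c = 0 this is monotonicity on nonnegative functions. *)
Lemma quasi_linear_le_add (R : realType) (X : topologicalType)
    (rho : (X -> R) -> R) (N c : R) (f g : X -> R) :
  quasi_linear rho ->
  (forall k, C0 k -> (forall x, 0 <= k x <= 1) -> rho k <= N) ->
  C0 f -> C0 g -> 0 <= c ->
  (forall x, f x <= g x + c) -> (forall x, 0 <= f x) -> (forall x, 0 <= g x) ->
  rho f <= rho g + c * N.
Proof.
move=> ql rN Cf Cg c0 fg f0 g0.
have min_id (k : X -> R) (b : R) : C0 k -> (unorm k <= b) -> (fun x => Num.min (k x) b) = k.
  move=> Ck kb; apply/funext => x; apply/min_idPl.
  by apply: le_trans kb; apply: le_trans (ler_norm _) (C0_le_unorm _ _ _ _ Ck).
have minb (b : R) : 0 <= b -> rho (fun x => Num.min (f x) b) <= b * N.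
  move=> b0; apply: (quasi_linear_bound _ _ _ _ _ _ ql rN b0); first exact: C0_min.
  by move=> x; rewrite le_min f0 b0 ge_min lexx orbT.
have step (d : R) : 0 < d -> rho f <= rho g + (c + d) * N.
  move=> d0.
  (* The slice inequalities at levels a = 0, d, ..., (n - 1) d telescope. *)
  have ind n : rho (fun x => Num.min (f x) (c + n%:R * d + d)) -
      rho (fun x => Num.min (f x) (c + d)) <= rho (fun x => Num.min (g x) (n%:R * d)).
    elim: n => [|n IH].
      rewrite mul0r addr0 subrr (_ : (fun x => _) = cst 0).
        by rewrite (quasi_linear0 _ _ _ _ ql Cf).
      by apply/funext => x; apply/min_idPr.
    have nd : 0 <= n%:R * d by rewrite mulr_ge0// ltW.
    have := quasi_linear_slice _ _ _ _ _ _ _ _ ql Cf Cg nd c0 (ltW d0) fg f0 g0.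
    have -> : n.+1%:R * d = n%:R * d + d by rewrite -natr1 mulrDl mul1r.
    by rewrite addrA; lra.
  (* Now n d exceeds both norms, so the top truncations leave f and g unchanged. *)
  have [n hn] : exists n : nat, (unorm f + unorm g) / d < n%:R.
    exists (Num.bound ((unorm f + unorm g) / d)); rewrite archi_boundP//.
    by rewrite divr_ge0 ?addr_ge0 ?unorm_ge0// ltW.
  rewrite ltr_pdivrMr// in hn.
  have nf := unorm_ge0 _ _ _ Cf; have ng := unorm_ge0 _ _ _ Cg.
  have := ind n; rewrite (min_id f)//; last by lra.
  rewrite (min_id g)//; last by lra.
  by have := minb (c + d) (addr_ge0 c0 (ltW d0)); lra.
have N0 : 0 <= N.
  rewrite -(quasi_linear0 _ _ _ _ ql Cf); apply: rN => [|x /=]; last by rewrite lexx ler01.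
  by rewrite (_ : cst 0 = f \- f); [exact: C0B|apply/funext => x /=; rewrite subrr].
apply/ler_addgt0Pr => e e0.
(* The thickness is d = e / (N + 1), as N may be 0. *)
have dN : e / (N + 1) * N <= e.
  by rewrite mulrAC ler_pdivrMr; nra.
have := step (e / (N + 1)); rewrite divr_gt0//; last by lra.
by move=> /(_ isT); rewrite mulrDl; lra.
Qed.

Lemma quasi_linear_sub_le (R : realType) (X : topologicalType)
    (rho : (X -> R) -> R) (N c : R) (f g : X -> R) :
  quasi_linear rho ->
  (forall k, C0 k -> (forall x, 0 <= k x <= 1) -> rho k <= N) ->
  C0 f -> C0 g -> 0 <= c ->
  (forall x, `|f x - g x| <= c) -> (forall x, 0 <= f x) -> (forall x, 0 <= g x) ->
  `|rho f - rho g| <= c * N.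
Proof.
move=> ql rN Cf Cg c0 fg f0 g0; rewrite ler_norml.
have h1 : rho f <= rho g + c * N.
  by apply: quasi_linear_le_add => // x; have := fg x; rewrite ler_norml; lra.
have h2 : rho g <= rho f + c * N.
  by apply: quasi_linear_le_add => // x; have := fg x; rewrite ler_norml; lra.
lra.
Qed.

(** * Signed functions *)

(** This is max(f, 0), written through a truncation because truncations stay in S(f). *)
Definition fpos (R : realType) (X : topologicalType) (f : X -> R) : X -> R :=
  f \- (fun x => Num.min (f x) 0).
Arguments fpos {R X} f.

(** This is max(-f, 0), written as a scalar multiple so that homogeneity applies. *)
Definition fneg (R : realType) (X : topologicalType) (f : X -> R) : X -> R :=
  fun x => -1 * Num.min (f x) 0.
Arguments fneg {R X} f.

Lemma C0_fpos (R : realType) (X : topologicalType) (f : X -> R) :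
  C0 f -> C0 (fpos f).
Proof. by move=> Cf; apply: C0B => //; exact: C0_min. Qed.

Lemma C0_fneg (R : realType) (X : topologicalType) (f : X -> R) :
  C0 f -> C0 (fneg f).
Proof. by move=> Cf; apply: C0Z; exact: C0_min. Qed.

Lemma fpos_ge0 (R : realType) (X : topologicalType) (f : X -> R) x :
  0 <= fpos f x.
Proof. by rewrite subr_ge0 ge_min lexx. Qed.

Lemma fneg_ge0 (R : realType) (X : topologicalType) (f : X -> R) x :
  0 <= fneg f x.
Proof. by rewrite /fneg mulN1r oppr_ge0 ge_min lexx orbT. Qed.

Lemma quasi_linear_pos_neg (R : realType) (X : topologicalType)
    (rho : (X -> R) -> R) (f : X -> R) :
  quasi_linear rho -> C0 f -> rho f = rho (fpos f) - rho (fneg f).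
Proof.
move=> ql Cf; have Cm : C0 (fun x => Num.min (f x) 0) by exact: C0_min.
have [rZ _ _] := ql; rewrite /fneg rZ// (quasi_linearB _ _ _ f)//; first by lra.
  exact: Sgen_gen.
by apply: Sgen_min => //; exact: Sgen_gen.
Qed.

(** The values of [rho] on the two parts both lie in [0, [unorm f * N]], so their difference obeys
    the same bound without a factor 2. *)
Lemma quasi_linear_norm_le (R : realType) (X : topologicalType)
    (rho : (X -> R) -> R) (N : R) (f : X -> R) :
  quasi_linear rho ->
  (forall k, C0 k -> (forall x, 0 <= k x <= 1) -> rho k <= N) ->
  C0 f -> `|rho f| <= unorm f * N.
Proof.
move=> ql rN Cf; have [_ _ rpos] := ql.
have fu x : `|f x| <= unorm f by exact: C0_le_unorm.
have bnd k : C0 k -> (forall x, 0 <= k x) -> (forall x, k x <= `|f x|) ->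
    0 <= rho k <= unorm f * N.
  move=> Ck k0 kf; rewrite rpos//=.
  apply: (quasi_linear_bound _ _ _ _ _ _ ql rN) => //; first exact: unorm_ge0.
  by move=> x; rewrite k0 (le_trans (kf x)).
have : 0 <= rho (fpos f) <= unorm f * N.
  apply: bnd; [exact: C0_fpos|exact: fpos_ge0|move=> x].
  by rewrite /fpos /=; have := ler_norm (f x); have := ler_norm (- f x);
    rewrite normrN; case: (leP (f x) 0); lra.
have : 0 <= rho (fneg f) <= unorm f * N.
  apply: bnd; [exact: C0_fneg|exact: fneg_ge0|move=> x].
  by rewrite /fneg; have := ler_norm (f x); have := ler_norm (- f x);
    rewrite normrN; case: (leP (f x) 0); lra.
rewrite (quasi_linear_pos_neg _ _ _ f ql Cf) ler_norml; lra.
Qed.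

(** Taking positive or negative parts is 1-Lipschitz, so the nonnegative case bounds each part; the
    two errors add up to the factor 2. *)
Lemma quasi_linear_lipschitz (R : realType) (X : topologicalType)
    (rho : (X -> R) -> R) (N : R) (f g : X -> R) :
  quasi_linear rho ->
  (forall k, C0 k -> (forall x, 0 <= k x <= 1) -> rho k <= N) ->
  C0 f -> C0 g -> `|rho f - rho g| <= 2 * unorm (f \- g) * N.
Proof.
move=> ql rN Cf Cg.
have fu x : `|f x - g x| <= unorm (f \- g).
  by apply: (C0_le_unorm _ _ (f \- g)); exact: C0B.
have u0 : 0 <= unorm (f \- g) by apply: unorm_ge0; exact: C0B.
have : `|rho (fpos f) - rho (fpos g)| <= unorm (f \- g) * N.
  apply: quasi_linear_sub_le => //; try exact: C0_fpos; try exact: fpos_ge0.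
  move=> x; have := fu x; rewrite /fpos /= !ler_norml.
  by case: (leP (f x) 0); case: (leP (g x) 0); lra.
have : `|rho (fneg f) - rho (fneg g)| <= unorm (f \- g) * N.
  apply: quasi_linear_sub_le => //; try exact: C0_fneg; try exact: fneg_ge0.
  move=> x; have := fu x; rewrite /fneg /= !ler_norml.
  by case: (leP (f x) 0); case: (leP (g x) 0); lra.
rewrite (quasi_linear_pos_neg _ _ _ f ql Cf) (quasi_linear_pos_neg _ _ _ g ql Cg).
rewrite !ler_norml; lra.
Qed.

(** * Compact supports and the total mass *)

Lemma Cc_C0 (R : realType) (X : topologicalType) (f : X -> R) : Cc f -> C0 f.
Proof.
move=> [cf Kf]; split => // e e0.
apply: (subclosed_compact _ Kf); first exact: closed_norm_ge.
move=> x /= ex; apply: subset_closure => /=.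
by rewrite -normr_gt0 (lt_le_trans e0).
Qed.

Lemma C0_0 (R : realType) (X : topologicalType) : C0 (cst 0 : X -> R).
Proof.
split=> [x|e e0]; first exact: (@cst_continuous X R^o 0 x).
rewrite (_ : [set _ | _] = set0); first exact: compact0.
by apply/seteqP; split => // x /=; rewrite normr0 leNgt e0.
Qed.

(** The difference is nonzero only where f > e, so its support lies in the closed compact set where
    f >= e. *)
Lemma Cc_truncation (R : realType) (X : topologicalType) (f : X -> R) (e : R) :
  0 < e -> C0 f -> (forall x, 0 <= f x) ->
  Cc (f \- (fun x => Num.min (f x) e)).
Proof.
move=> e0 Cf f0; have [cf Kf] := Cf.
have [ch _] : C0 (f \- (fun x => Num.min (f x) e)).
  by apply: C0B => //; apply: C0_min => //; exact: ltW.
split => //; apply: subclosed_compact (Kf _ e0) _; first exact: closed_closure.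
have /closure_id -> := closed_norm_ge _ _ f e cf.
apply: closure_subset => x /=; rewrite (ger0_norm (f0 x)).
by case: (leP (f x) e) => [|/ltW//]; rewrite subrr eqxx.
Qed.

Lemma ql_norm_fin (R : realType) (X : topologicalType) (rho : (X -> R) -> R) :
  quasi_linear rho -> (ql_norm rho < +oo)%E -> ql_norm rho = (fine (ql_norm rho))%:E.
Proof.
move=> ql fin; rewrite fineK// ge0_fin_numE//.
(* The zero function makes the supremum nonnegative, which excludes the value -oo. *)
apply: ereal_sup_ubound; exists (cst 0).
  by split; [exact: C0_0|move=> x /=; rewrite lexx ler01].
by rewrite (quasi_linear0 _ _ _ _ ql (C0_0 _ _)).
Qed.

Lemma le_ql_norm (R : realType) (X : topologicalType) (rho : (X -> R) -> R)
    (f : X -> R) :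
  quasi_linear rho -> (ql_norm rho < +oo)%E ->
  C0 f -> (forall x, 0 <= f x <= 1) -> rho f <= fine (ql_norm rho).
Proof.
move=> ql fin Cf f01; rewrite -lee_fin -ql_norm_fin//.
by apply: ereal_sup_ubound; exists f.
Qed.

(** Each f competing for the norm is replaced by f - min(f, d), which competes for mu(X); additivity
    on S(f) bounds the loss by d N. *)
Lemma mu_rho_setT (R : realType) (X : topologicalType) (rho : (X -> R) -> R) :
  quasi_linear rho -> (ql_norm rho < +oo)%E ->
  mu_rho rho [set: X] = ql_norm rho.
Proof.
move=> ql fin; rewrite /mu_rho asboolT; last exact: openT.
apply/eqP; rewrite eq_le; apply/andP; split.
  apply: le_ereal_sup => _ [f [Cf f01 _] <-].
  by exists f => //; split => //; exact: Cc_C0.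
apply: ge_ereal_sup => _ [f [Cf f01] <-].
apply/lee_addgt0Pr => e e0.
have f0 x : 0 <= f x by have /andP[] := f01 x.
pose N := fine (ql_norm rho).
have N0 : 0 <= N.
  rewrite -(quasi_linear0 _ _ _ _ ql Cf).
  by apply: le_ql_norm => //; [exact: C0_0|move=> x /=; rewrite lexx ler01].
have d0 : 0 < e / (N + 1) by rewrite divr_gt0//; lra.
have dN : e / (N + 1) * N <= e by rewrite mulrAC ler_pdivrMr; nra.
move: (e / (N + 1)) d0 dN => d d0 dN.
have Cm : C0 (fun x => Num.min (f x) d) by apply: C0_min => //; exact: ltW.
have hm : rho (fun x => Num.min (f x) d) <= d * N.
  apply: quasi_linear_bound => //; first by move=> k; exact: le_ql_norm.
    exact: ltW.
  by move=> x; rewrite le_min f0 (ltW d0) ge_min lexx orbT.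
apply: (@le_trans _ _ ((rho (f \- (fun x => Num.min (f x) d)))%:E + e%:E)%E).
  rewrite -EFinD lee_fin (quasi_linearB _ _ _ f)//; first by lra.
    exact: Sgen_gen.
  by apply: Sgen_min; [exact: ltW|exact: Sgen_gen].
apply: leeD => //; apply: ereal_sup_ubound.
exists (f \- (fun x => Num.min (f x) d)) => //; split => //.
  exact: Cc_truncation.
move=> x /=; have /andP[fx0 fx1] := f01 x.
by case: (leP (f x) d) => h; lra.
Qed.

Local Open Scope ereal_scope.

Theorem corollary53 (R : realType) (X : topologicalType)
    (locX : locally_compact [set: X]) (hausX : hausdorff_space X)
    (connX : connected [set: X])
    (rho : (X -> R) -> R) (rho_ql : quasi_linear rho)
    (rho_fin : ql_norm rho < +oo) :
  [/\ forall f : X -> R, C0 f ->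
        `|rho f|%R%:E <= (unorm f)%:E * mu_rho rho [set: X] /\
        (unorm f)%:E * mu_rho rho [set: X] = (unorm f)%:E * ql_norm rho,
      forall f g : X -> R, C0 f -> C0 g ->
        (forall x, (0 <= f x)%R) -> (forall x, (0 <= g x)%R) ->
        `|rho f - rho g|%R%:E <= (unorm (f \- g)%R)%:E * mu_rho rho [set: X] /\
        (unorm (f \- g)%R)%:E * mu_rho rho [set: X]
          = (unorm (f \- g)%R)%:E * ql_norm rho &
      forall f g : X -> R, C0 f -> C0 g ->
        `|rho f - rho g|%R%:E
          <= 2%:E * (unorm (f \- g)%R)%:E * mu_rho rho [set: X] /\
        2%:E * (unorm (f \- g)%R)%:E * mu_rho rho [set: X]
          = 2%:E * (unorm (f \- g)%R)%:E * ql_norm rho].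
Proof.
(* With mu(X) and the norm turned into one real number, the equalities become trivial and the
   inequalities real. *)
rewrite mu_rho_setT// ql_norm_fin//.
have rN k := le_ql_norm R X rho k rho_ql rho_fin.
split=> [f Cf|f g Cf Cg f0 g0|f g Cf Cg]; split => //;
  rewrite -?EFinM lee_fin.
- exact: quasi_linear_norm_le.
- apply: quasi_linear_sub_le => //; first by apply: unorm_ge0; exact: C0B.
  by move=> x; apply: (C0_le_unorm _ _ (f \- g)%R); exact: C0B.
- exact: quasi_linear_lipschitz.
Qed.
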